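(* Let $k$ be an integer, $k>1$. Then, for every $\alpha \in \mathbb{Q} \setminus \mathbb{Z}$, the following closed-form summation holds: $$\sum_{n=-\infty}^{+\infty}\frac{1}{(n+\alpha)^k} = (-1)^{\left\lfloor \frac{k+2}{2} \right\rfloor}\, \frac{(2\pi q)^k}{q\, k!}\, \sum_{s=1}^{q} B_k\!\left(\frac{s}{q}\right) f_k(2\pi s\,\widetilde{\alpha}),$$ where $\widetilde{\alpha} := \alpha - \lfloor \alpha \rfloor$ is the representative of $\alpha$ in $(0,1)$, $f_k(\theta)=\cos\theta$ if $k$ is even and $f_k(\theta)=\sin\theta$ if $k$ is odd, and $q>1$ is the denominator of $\widetilde{\alpha}$.
   Context: $\lfloor x\rfloor$ is the greatest integer less than or equal to $x$. $B_n(x)$ denotes the Bernoulli polynomial of degree $n$, defined by $\frac{t e^{tx}}{e^t-1}=\sum_{n=0}^{\infty} B_n(x)\frac{t^n}{n!}$ for $0<|t|<2\pi$. The denominator of a rational number is its positive denominator in lowest terms. The bilateral series, over all $n\in\mathbb{Z}$, converges absolutely. *)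

(* Defs.v *)
(* Stdlib / Coquelicot real numbers. *)
From Stdlib Require Import Reals ZArith QArith Qround Qreals.
From Coquelicot Require Import Coquelicot.

Local Open Scope R_scope.

(* [B n x] is the value at [x] of the Bernoulli polynomial of degree [n].  Real
   [t] suffice: a power series is determined by its sums on a punctured real
   neighbourhood of 0, so at most one [B] satisfies this, up to pointwise
   equality. *)
Definition is_bernoulli (B : nat -> R -> R) : Prop :=
  forall x t : R, 0 < Rabs t < 2 * PI ->
    is_series (fun n : nat => B n x * (t ^ n / INR (fact n)))
              (t * exp (t * x) / (exp t - 1)).

(* Absolute convergence is part of the definition, so the value does not depend
   on how the terms indexed by [Z] are arranged; in particular splitting them
   at 0 involves no choice. *)
Definition is_bilateral_series (a : Z -> R) (l : R) : Prop :=
  ex_series (fun n : nat => Rabs (a (Z.of_nat n))) /\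
  ex_series (fun n : nat => Rabs (a (- Z.of_nat (S n))%Z)) /\
  Series (fun n : nat => a (Z.of_nat n)) +
    Series (fun n : nat => a (- Z.of_nat (S n))%Z) = l.

Definition Qfrac (r : Q) : Q := (r - inject_Z (Qfloor r))%Q.

(* Elements of [Q] need not be in lowest terms, hence [Qred]. *)
Definition denominator (r : Q) : nat := Pos.to_nat (Qden (Qred r)).

Definition trig (k : nat) (theta : R) : R :=
  if Nat.even k then cos theta else sin theta.

(* Main.v *)
Require Import Defs.
From Stdlib Require Import Reals ZArith QArith Qround Qreals Lra Lia.
From Coquelicot Require Import Coquelicot.
Local Open Scope R_scope.

(** Both sides of the closed form are Taylor coefficients of the cotangent.

    Left-hand side.  Let S_k(x) be the sum of (n + x)^-k over all integers n, for
    x in (0,1).  Herglotz's trick gives S_2(x) = (pi / sin (pi x))^2: the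
    difference of the two sides is bounded on (0,1) and satisfies
    h(x/2) + h((x+1)/2) = 4 h(x), hence vanishes ([hurwitz2_reflection]).
    Termwise differentiation gives S_k' = - k S_(k+1), so that
    (-1)^(k-1) S_k is the Taylor coefficient of order k - 1 of
    f(x) = pi cot (pi x) + i pi at x ([cot_taylor_family]).  With
    w = exp (2 pi i x), the equation w f - f = 2 pi i w, differentiated k times,
    is a linear recurrence for these coefficients ([cot_taylor_recurrence]),
    whose solution is unique because w <> 1.

    Right-hand side.  Let q x be an integer, so that w^q = 1, and put
    r_k = q^k / k! times the sum of B_k(s/q) w^s for s = 1, ..., q.  The addition
    formula and the difference equation of the Bernoulli polynomials, both
    read off the generating function, make the sums r_k telescope
    to w (sum of r_j / (k-j)! for j <= k) - r_k = w q / (k-1)!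
    ([bernoulli_sum_recurrence]).  This is the recurrence above, up to the factor
    (2 pi i)^k / q and the shift of the index by one.  So the two agree
    ([cot_taylor_bernoulli]), and taking real parts gives the closed form for
    x in (0,1).

    The sum over all integers does not change when x is translated by an
    integer ([is_bilateral_series_shift]), which reduces a general rational to its
    fractional part. *)

(** * Termwise differentiation of dominated series *)

Lemma sum_Sn_R (a : nat -> R) (n : nat) : sum_n a (S n) = sum_n a n + a (S n).
Proof. apply (sum_Sn a n). Qed.

Lemma Weierstrass_CVU (f : nat -> R -> R) (M : nat -> R) (D : R -> Prop) :
  (forall n x, D x -> Rabs (f n x) <= M n) -> ex_series M ->
  CVU_dom (fun n x => sum_n (fun i => f i x) n) D.
Proof.
intros Hf HM; apply CVU_dom_cauchy; intros eps.
destruct (Cauchy_ex_series M HM eps) as [N HN].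
exists N.
assert (H : forall n m x, D x -> (N <= m)%nat -> (m < n)%nat ->
  Rabs (sum_n (fun i => f i x) n - sum_n (fun i => f i x) m) < eps).
{ intros n m x Dx Hm Hmn.
  replace (sum_n (fun i => f i x) n - sum_n (fun i => f i x) m)
    with (sum_n_m (fun i => f i x) (S m) n)
    by (apply (@sum_n_m_sum_n R_AbelianGroup); lia).
  eapply Rle_lt_trans; [apply (norm_sum_n_m (fun i => f i x))|].
  eapply Rle_lt_trans; [|apply (HN (S m) n); lia].
  eapply Rle_trans; [|apply Rle_abs].
  apply sum_n_m_le; intros k; apply (Hf k x Dx). }
intros n m x Dx Hn Hm.
destruct (Nat.lt_total n m) as [L|[L|L]].
- rewrite Rabs_minus_sym; apply H; assumption.
- subst; replace (_ - _) with 0 by ring; rewrite Rabs_R0; apply cond_pos.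
- apply H; assumption.
Qed.

(** The derivatives are dominated too, so both the partial sums and their
    derivatives converge uniformly on the half-line, and limit and derivative
    commute there. *)
Lemma is_derive_Series (f f' : nat -> R -> R) (M M' : nat -> R) (a : R) :
  (forall n x, a < x -> is_derive (f n) x (f' n x)) ->
  (forall n x, a < x -> continuous (f' n) x) ->
  (forall n x, a < x -> Rabs (f n x) <= M n) -> ex_series M ->
  (forall n x, a < x -> Rabs (f' n x) <= M' n) -> ex_series M' ->
  forall x, a < x ->
  is_derive (fun y => Series (fun n => f n y)) x (Series (fun n => f' n x)).
Proof.
intros Hd Hc HM eM HM' eM' x Hx.
assert (HD : forall n y, a < y ->
  is_derive (fun z => sum_n (fun i => f i z) n) y (sum_n (fun i => f' i y) n)).
{ intros n y Hy.
  apply (is_derive_sum_n f n y (fun i => f' i y)); intros; apply Hd, Hy. }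
assert (E : forall n y, a < y ->
  Derive (fun z => sum_n (fun i => f i z) n) y = sum_n (fun i => f' i y) n).
{ intros n y Hy; apply is_derive_unique, HD, Hy. }
unfold Series.
rewrite <- (Lim_seq_ext _ _ (fun n => E n x Hx)).
apply (CVU_Derive (fun n z => sum_n (fun i => f i z) n) (fun z => a < z)).
- apply open_gt.
- intros u v w Hu Hv Hw; lra.
- apply (Weierstrass_CVU f M); assumption.
- intros n y Hy; eexists; apply HD, Hy.
- intros n y Hy.
  apply continuity_pt_filterlim.
  apply (continuous_ext_loc _ (fun z => sum_n (fun i => f' i z) n)).
  + assert (L : locally y (fun z => a < z)) by (apply (open_gt a y Hy)).
    revert L; apply filter_imp; intros z Hz; symmetry; apply E, Hz.
  + induction n as [|n IH].
    * apply (continuous_ext (f' 0%nat)); [|apply Hc, Hy].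
      intros z; symmetry; apply sum_O.
    * apply (continuous_ext (fun z => plus (sum_n (fun i => f' i z) n) (f' (S n) z))).
      { intros z; symmetry; apply sum_Sn. }
      apply (@continuous_plus R_UniformSpace R_AbsRing R_NormedModule (fun z => sum_n (fun i => f' i z) n)); [apply IH|apply Hc, Hy].
- apply CVU_dom_cauchy.
  assert (W := Weierstrass_CVU f' M' (fun z => a < z) HM' eM').
  apply CVU_dom_cauchy in W.
  intros eps; destruct (W eps) as [N HN]; exists N.
  intros n m y Hy Hn Hm; rewrite !E by assumption; apply HN; assumption.
- exact Hx.
Qed.

(** * The one-sided sums over n of (n + x)^-k *)

Definition hurwitz (k : nat) (x : R) : R := Series (fun n => / (INR n + x) ^ k).

(** Comparison with the telescoping series of 1/y - 1/(y+1), where y = n + x: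
    each term after the first satisfies 1/(y+1)^2 <= 1/y - 1/(y+1).  The
    explicit bound is what makes the Herglotz argument below start. *)
Lemma hurwitz2_bounds (x : R) : 0 < x ->
  ex_series (fun n => / (INR n + x) ^ 2) /\
  0 <= hurwitz 2 x <= / x ^ 2 + / x.
Proof.
intros Hx.
assert (P : forall n, 0 < INR n + x) by (intros n; pose proof (pos_INR n); lra).
assert (P' : forall n, 0 < / (INR n + x) ^ 2).
{ intros n; apply Rinv_0_lt_compat, pow_lt, P. }
assert (B : forall n, sum_n (fun n => / (INR n + x) ^ 2) n <= / x ^ 2 + / x - / (INR n + x)).
{ induction n as [|n IH].
  - rewrite sum_O; simpl INR; rewrite Rplus_0_l; lra.
  - rewrite sum_Sn_R.
    eapply Rle_trans; [apply Rplus_le_compat_r, IH|].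
    rewrite S_INR; specialize (P n); set (y := INR n + x) in *.
    replace (INR n + 1 + x) with (y + 1) by (unfold y; ring).
    assert (/ (y+1)^2 <= / y - / (y+1)); [|lra].
    replace (/ y - / (y + 1)) with (/ (y * (y + 1))) by (field; lra).
    apply Rinv_le_contravar; [apply Rmult_lt_0_compat; lra|].
    replace ((y + 1) ^ 2) with (y * (y + 1) + (y + 1)) by ring; lra. }
assert (B0 : forall n, 0 <= sum_n (fun n => / (INR n + x) ^ 2) n).
{ induction n; [rewrite sum_O; left; apply P'|].
  rewrite sum_Sn_R; apply Rplus_le_le_0_compat; [exact IHn|left; apply P']. }
assert (B1 : forall n, sum_n (fun n => / (INR n + x) ^ 2) n <= / x ^ 2 + / x).
{ intros n; specialize (B n); specialize (P n); apply Rinv_0_lt_compat in P; lra. }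
assert (E : ex_finite_lim_seq (sum_n (fun n => / (INR n + x) ^ 2))).
{ apply (ex_finite_lim_seq_incr _ (/ x ^ 2 + / x)); [|exact B1].
  intros n; rewrite sum_Sn_R; specialize (P' (S n)); lra. }
destruct E as [l Hl].
split; [exists l; exact Hl|].
unfold hurwitz; rewrite (is_series_unique _ l) by exact Hl.
split.
- apply (is_lim_seq_le (fun _ => 0) _ 0 l B0); [apply is_lim_seq_const|exact Hl].
- apply (is_lim_seq_le _ (fun _ => / x ^ 2 + / x) l (/ x ^ 2 + / x) B1 Hl), is_lim_seq_const.
Qed.

Lemma ex_series_hurwitz (k : nat) (x : R) : (2 <= k)%nat -> 0 < x ->
  ex_series (fun n => / (INR n + x) ^ k).
Proof.
intros Hk Hx.
assert (P : forall n, x <= INR n + x) by (intros n; pose proof (pos_INR n); lra).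
apply (@ex_series_le R_AbsRing R_CompleteNormedModule _ (fun n => / x ^ (k - 2) * / (INR n + x) ^ 2)).
- intros n; specialize (P n).
  change (Rabs (/ (INR n + x) ^ k) <= / x ^ (k - 2) * / (INR n + x) ^ 2).
  replace k with (k - 2 + 2)%nat at 1 by lia.
  rewrite pow_add, Rinv_mult, Rabs_right.
  + apply Rmult_le_compat_r; [left; apply Rinv_0_lt_compat, pow_lt; lra|].
    apply Rinv_le_contravar; [apply pow_lt, Hx|apply pow_incr; lra].
  + apply Rle_ge, Rmult_le_pos; left; apply Rinv_0_lt_compat, pow_lt; lra.
- apply (@ex_series_scal R_AbsRing R_NormedModule (/ x ^ (k - 2))
    (fun n => / (INR n + x) ^ 2)), hurwitz2_bounds, Hx.
Qed.

Lemma is_derive_hurwitz (k : nat) (x : R) : (2 <= k)%nat -> 0 < x ->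
  is_derive (hurwitz k) x (- INR k * hurwitz (S k) x).
Proof.
intros Hk Hx.
assert (P : forall n y, 0 < y -> 0 < INR n + y) by (intros n; pose proof (pos_INR n); intros; lra).
unfold hurwitz at 2; rewrite <- Series_scal_l.
(* the terms decrease in y, so their values at x / 2 dominate beyond x / 2 *)
apply (is_derive_Series (fun n y => / (INR n + y) ^ k)
  (fun n y => - INR k * / (INR n + y) ^ S k)
  (fun n => / (INR n + x / 2) ^ k)
  (fun n => INR k * / (INR n + x / 2) ^ S k) (x / 2)); try lra.
- intros n y Hy.
  specialize (P n y ltac:(lra)).
  auto_derive; [apply pow_nonzero; lra|].
  destruct k as [|k]; [lia|].
  set (c := INR (S k)). simpl pred. simpl pow; field.
  split; try apply pow_nonzero; lra.
- intros n y Hy. apply (ex_derive_continuous (fun z => - INR k * / (INR n + z) ^ S k)).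
  auto_derive. specialize (P n y ltac:(lra)).
  apply (pow_nonzero _ (S k)); lra.
- intros n y Hy; rewrite Rabs_right.
  + apply Rinv_le_contravar; [apply pow_lt, P; lra|apply pow_incr].
    specialize (P n (x/2) ltac:(lra)); lra.
  + apply Rle_ge; left; apply Rinv_0_lt_compat, pow_lt, P; lra.
- apply ex_series_hurwitz; [exact Hk|lra].
- intros n y Hy; rewrite Rabs_mult, Rabs_Ropp, Rabs_right by (apply Rle_ge, pos_INR).
  apply Rmult_le_compat_l; [apply pos_INR|].
  rewrite Rabs_right.
  + apply Rinv_le_contravar; [apply pow_lt, P; lra|apply pow_incr].
    specialize (P n (x/2) ltac:(lra)); lra.
  + apply Rle_ge; left; apply Rinv_0_lt_compat, pow_lt, P; lra.
- apply (@ex_series_scal R_AbsRing R_NormedModule (INR k)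
    (fun n => / (INR n + x / 2) ^ S k)), ex_series_hurwitz; [lia|lra].
Qed.

Lemma hurwitz_succ (k : nat) (x : R) : (2 <= k)%nat -> 0 < x ->
  hurwitz k x = / x ^ k + hurwitz k (x + 1).
Proof.
intros Hk Hx; unfold hurwitz.
rewrite Series_incr_1 by (apply ex_series_hurwitz; assumption).
change (INR 0) with 0; rewrite Rplus_0_l; f_equal.
apply Series_ext; intros n; rewrite S_INR; do 2 f_equal; ring.
Qed.

(** The halved arguments enumerate the even and the odd terms of the series
    at x, so the partial sums up to N on the left make up the one up to 2N+1. *)
Lemma hurwitz_duplication (k : nat) (x : R) : (2 <= k)%nat -> 0 < x ->
  hurwitz k (x / 2) + hurwitz k ((x + 1) / 2) = 2 ^ k * hurwitz k x.
Proof.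
intros Hk Hx.
assert (E : forall y, 0 < y ->
  is_lim_seq (sum_n (fun n => / (INR n + y) ^ k)) (hurwitz k y)).
{ intros y Hy; apply Series_correct, ex_series_hurwitz; assumption. }
assert (F : forall N, sum_n (fun n => / (INR n + x / 2) ^ k) N
    + sum_n (fun n => / (INR n + (x + 1) / 2) ^ k) N
    = 2 ^ k * sum_n (fun n => / (INR n + x) ^ k) (2 * N + 1)).
{ assert (H2 : forall y, 0 < y -> / (y / 2) ^ k = 2 ^ k * / y ^ k).
  { intros y Hy; unfold Rdiv; rewrite Rpow_mult_distr, pow_inv; field.
    split; apply pow_nonzero; lra. }
  induction N as [|N IH].
  - simpl Nat.add; rewrite sum_Sn_R, !sum_O; simpl INR; rewrite !Rplus_0_l, !H2, (Rplus_comm 1 x) by lra; ring.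
  - replace (2 * S N + 1)%nat with (S (S (2 * N + 1))) by lia.
    rewrite !sum_Sn_R.
    replace (INR (S N) + x / 2) with ((INR (S (2 * N + 1)) + x) / 2)
      by (rewrite !S_INR, plus_INR, mult_INR; simpl; field).
    replace (INR (S N) + (x + 1) / 2) with ((INR (S (S (2 * N + 1))) + x) / 2)
      by (rewrite !S_INR, plus_INR, mult_INR; simpl; field).
    rewrite !H2 by (match goal with |- 0 < INR ?n + x =>
       pose proof (pos_INR n); lra end).
    rewrite !Rmult_plus_distr_l, <- IH; ring. }
assert (L := is_lim_seq_plus' _ _ _ _ (E (x / 2) ltac:(lra)) (E ((x + 1) / 2) ltac:(lra))).
assert (L' : is_lim_seq (fun N => 2 ^ k * sum_n (fun n => / (INR n + x) ^ k) (2 * N + 1))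
   (2 ^ k * hurwitz k x)).
{ apply (is_lim_seq_scal_l (fun N => sum_n (fun n => / (INR n + x) ^ k) (2 * N + 1)) (2 ^ k) (hurwitz k x)).
  apply (is_lim_seq_subseq _ _ (fun N => (2 * N + 1)%nat)); [|apply E, Hx].
  apply eventually_subseq; intros; lia. }
apply (is_lim_seq_ext _ _ _ F) in L.
apply is_lim_seq_unique in L; apply is_lim_seq_unique in L'.
rewrite L in L'; injection L'; auto.
Qed.

(** * The bilateral sum of order two *)

(** The upper bound is 1/sin^2 = 1 + cot^2 together with cot y <= 1/y, that is
    y cos y <= sin y; the latter holds since sin t - t cos t has the nonnegative
    derivative t sin t. *)
Lemma inv_sin2_bounds (y : R) : 0 < y <= PI / 2 -> 0 <= / sin y ^ 2 - / y ^ 2 <= 1.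
Proof.
intros [Hy Hy2]. pose proof PI_RGT_0.
assert (Hs : 0 < sin y) by (apply sin_gt_0; lra).
assert (Hc : 0 <= cos y) by (apply cos_ge_0; lra).
pose proof (sin_lt_x y Hy).
assert (T : y * cos y <= sin y).
{ destruct (MVT_gen (fun t => sin t - t * cos t) 0 y (fun t => t * sin t)) as [c [Hc1 Hc2]].
  - intros c Hc'; auto_derive; [exact I|ring].
  - intros c Hc'; apply continuity_pt_filterlim, (ex_derive_continuous (fun t => sin t - t * cos t)).
    auto_derive; exact I.
  - rewrite Rmin_left, Rmax_right in Hc1 by lra.
    rewrite sin_0 in Hc2.
    assert (0 <= sin c) by (apply sin_ge_0; lra).
    assert (0 <= c * sin c * (y - 0)) by (apply Rmult_le_pos; [apply Rmult_le_pos|]; lra).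
    lra. }
pose proof (sin2_cos2 y) as E; unfold Rsqr in E.
split.
- assert (/ y ^ 2 <= / sin y ^ 2); [|lra].
  apply Rinv_le_contravar; [apply pow_lt, Hs|apply pow_incr; lra].
- assert (Q : / sin y ^ 2 - 1 = (cos y / sin y) ^ 2).
  { replace 1 with (sin y * sin y + cos y * cos y) at 1 by exact E.
    rewrite Rminus_def. apply (Rmult_eq_reg_r (sin y ^ 2)); [|apply pow_nonzero; lra].
    field_simplify; [|lra|lra].
    replace (cos y ^ 2) with (1 - sin y ^ 2) by (simpl; lra). ring. }
  assert (cos y / sin y <= / y).
  { apply (Rmult_le_reg_r (y * sin y)); [apply Rmult_lt_0_compat; lra|].
    replace (cos y / sin y * (y * sin y)) with (y * cos y) by (field; lra).
    replace (/ y * (y * sin y)) with (sin y) by (field; lra). exact T. }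
  assert ((cos y / sin y) ^ 2 <= (/ y) ^ 2).
  { apply pow_incr; split; [|assumption].
    apply Rmult_le_pos; [exact Hc|left; apply Rinv_0_lt_compat, Hs]. }
  rewrite pow_inv in *. lra.
Qed.

Lemma sin_PI_mult_pos (x : R) : 0 < x < 1 -> 0 < sin (PI * x).
Proof.
intros Hx; pose proof PI_RGT_0.
apply sin_gt_0; [apply Rmult_lt_0_compat; lra|].
apply Rlt_le_trans with (PI * 1); [apply Rmult_lt_compat_l; lra|lra].
Qed.

Definition csc2_defect (x : R) : R :=
  hurwitz 2 x + hurwitz 2 (1 - x) - (PI / sin (PI * x)) ^ 2.

Lemma csc2_defect_sym (x : R) : csc2_defect (1 - x) = csc2_defect x.
Proof.
unfold csc2_defect.
replace (PI * (1 - x)) with (PI - PI * x) by ring.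
rewrite sin_PI_x; replace (1 - (1 - x)) with x by ring; ring.
Qed.

(** Near 0 the poles of the two terms cancel: both are 1/x^2 plus something
    bounded.  The pole at 1 is the mirror image. *)
Lemma csc2_defect_bounded (x : R) : 0 < x < 1 -> Rabs (csc2_defect x) <= 20.
Proof.
assert (W : forall x, 0 < x <= 1 / 2 -> Rabs (csc2_defect x) <= 20).
{ clear x; intros x Hx. pose proof PI_RGT_0; pose proof PI_4.
  destruct (inv_sin2_bounds (PI * x)) as [L U].
  { split; [apply Rmult_lt_0_compat; lra|].
    apply Rle_trans with (PI * (1 / 2)); [apply Rmult_le_compat_l; lra|lra]. }
  assert (0 < sin (PI * x)) by (apply sin_PI_mult_pos; lra).
  assert (Q : (PI / sin (PI * x)) ^ 2 = PI ^ 2 * (/ sin (PI * x) ^ 2 - / (PI * x) ^ 2) + / x ^ 2).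
  { field; lra. }
  unfold csc2_defect; rewrite Q, (hurwitz_succ 2 x) by (lia || lra).
  set (d := / sin (PI * x) ^ 2 - / (PI * x) ^ 2) in *.
  destruct (hurwitz2_bounds (x + 1) ltac:(lra)) as [_ [A1 A2]].
  destruct (hurwitz2_bounds (1 - x) ltac:(lra)) as [_ [B1 B2]].
  assert (I : forall a y, 0 < a -> a <= y -> / y <= / a) by (intros; apply Rinv_le_contravar; assumption).
  assert (/ (x + 1) <= 1) by (rewrite <- Rinv_1; apply I; lra).
  assert (/ (x + 1) ^ 2 <= 1) by (rewrite <- Rinv_1; apply I; [lra|simpl; nra]).
  assert (/ (1 - x) <= 2) by (replace 2 with (/ (/ 2)) by lra; apply I; lra).
  assert (/ (1 - x) ^ 2 <= 4).
  { replace 4 with (/ (/ 4)) by lra; apply I; [lra|simpl; nra]. }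
  assert (PI ^ 2 <= 16) by (simpl; nra).
  assert (0 <= PI ^ 2 * d <= 16).
  { split; [apply Rmult_le_pos; [apply pow2_ge_0|lra]|].
    replace 16 with (16 * 1) by ring; apply Rmult_le_compat; try lra; apply pow2_ge_0. }
  apply Rabs_le; lra. }
intros Hx; destruct (Rle_dec x (1 / 2)); [apply W; lra|].
rewrite <- csc2_defect_sym; apply W; lra.
Qed.

(** The Hurwitz sums and 1/sin^2 obey the same duplication formula, the latter
    because 1/sin^2 y + 1/cos^2 y = 4/sin^2 (2y). *)
Lemma csc2_defect_duplication (x : R) : 0 < x < 1 ->
  csc2_defect (x / 2) + csc2_defect ((x + 1) / 2) = 4 * csc2_defect x.
Proof.
intros Hx; unfold csc2_defect.
pose proof (hurwitz_duplication 2 x ltac:(lia) ltac:(lra)) as E1.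
pose proof (hurwitz_duplication 2 (1 - x) ltac:(lia) ltac:(lra)) as E2.
replace (1 - x / 2) with ((1 - x + 1) / 2) by field.
replace (1 - (x + 1) / 2) with ((1 - x) / 2) by field.
pose proof PI_RGT_0.
set (y := PI * (x / 2)).
assert (Hy : 0 < y < PI / 2).
{ unfold y; split; [apply Rmult_lt_0_compat; lra|].
  apply Rlt_le_trans with (PI * (1 / 2)); [apply Rmult_lt_compat_l|]; lra. }
replace (PI * ((x + 1) / 2)) with (PI / 2 + y) by (unfold y; field).
replace (PI * x) with (2 * y) by (unfold y; field).
rewrite sin_2a. replace (sin (PI / 2 + y)) with (cos y) by (apply cos_sin).
assert (0 < sin y) by (apply sin_gt_0; lra).
assert (0 < cos y) by (apply cos_gt_0; lra).
assert (T : (PI / sin y) ^ 2 + (PI / cos y) ^ 2 = 4 * (PI / (2 * sin y * cos y)) ^ 2).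
{ pose proof (sin2_cos2 y) as E; unfold Rsqr in E.
  replace ((PI / sin y) ^ 2 + (PI / cos y) ^ 2) with
   (PI ^ 2 * (sin y * sin y + cos y * cos y) / (sin y * cos y) ^ 2) by (field; lra).
  rewrite E; field; lra. }
simpl pow in E1, E2. lra.
Qed.

(** Herglotz's trick: by duplication 4 h(x) is a sum of two values of the defect
    h, so any bound for |h| on (0,1) may be halved, again and again. *)
Lemma hurwitz2_reflection (x : R) : 0 < x < 1 ->
  hurwitz 2 x + hurwitz 2 (1 - x) = (PI / sin (PI * x)) ^ 2.
Proof.
assert (B : forall n x, 0 < x < 1 -> Rabs (csc2_defect x) <= 20 * (1 / 2) ^ n).
{ clear x; induction n as [|n IH]; intros x Hx.
  - rewrite pow_O, Rmult_1_r; apply csc2_defect_bounded, Hx.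
  - pose proof (csc2_defect_duplication x Hx) as E.
    pose proof (IH (x / 2) ltac:(lra)) as A1.
    pose proof (IH ((x + 1) / 2) ltac:(lra)) as A2.
    apply Rabs_le_between in A1; apply Rabs_le_between in A2.
    apply Rabs_le; simpl pow; lra. }
intros Hx; specialize (fun n => B n x Hx).
assert (Z : csc2_defect x = 0).
{ destruct (Req_dec (csc2_defect x) 0) as [E|N]; [exact E|exfalso].
  apply Rabs_pos_lt in N.
  destruct (pow_lt_1_zero (1 / 2) ltac:(rewrite Rabs_right; lra) (Rabs (csc2_defect x) / 20) ltac:(lra)) as [n Hn].
  specialize (Hn n (le_n n)); specialize (B n).
  rewrite Rabs_right in Hn by (apply Rle_ge, pow_le; lra). lra. }
unfold csc2_defect in Z; lra.
Qed.

(** * Finite sums of complex numbers *)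

Definition twopii : C := (0, 2 * PI).

Definition omega (x : R) : C := (cos (2 * PI * x), sin (2 * PI * x)).

(** Sums have their type presented through a monoid structure; [ring] needs to
    see the carrier itself. *)
Ltac C_ring := match goal with |- ?a = ?b => change (@eq C a b) end; ring.

Lemma sum_Sn_C (a : nat -> C) (n : nat) : sum_n a (S n) = (sum_n a n + a (S n))%C.
Proof. apply (sum_Sn a n). Qed.

Lemma sum_n_ext_C (a b : nat -> C) (n : nat) :
  (forall i, (i <= n)%nat -> a i = b i) -> sum_n a n = sum_n b n.
Proof. apply (@sum_n_ext_loc C_AbelianMonoid). Qed.

Lemma sum_n_mult_C (c : C) (a : nat -> C) (n : nat) :
  sum_n (fun i => c * a i)%C n = (c * sum_n a n)%C.
Proof. apply (@sum_n_mult_l C_Ring). Qed.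

Lemma sum_n_plus_C (a b : nat -> C) (n : nat) :
  sum_n (fun i => a i + b i)%C n = (sum_n a n + sum_n b n)%C.
Proof. apply (@sum_n_plus C_AbelianMonoid). Qed.

Lemma sum_n_first_C (a : nat -> C) (n : nat) :
  sum_n a (S n) = (a 0%nat + sum_n (fun i => a (S i)) n)%C.
Proof.
unfold sum_n; rewrite sum_Sn_m by lia; rewrite <- sum_n_m_S; reflexivity.
Qed.

Lemma RtoC_neq_0 (r : R) : r <> 0 -> RtoC r <> RtoC 0.
Proof. intros H E; injection E; exact H. Qed.

(** * Families of Taylor coefficients *)

(** Componentwise derivative of a complex-valued function of a real variable,
    for which the product rule comes from the real one. *)
Definition is_derive_C (f : R -> C) (x : R) (l : C) : Prop :=
  is_derive (fun t => fst (f t)) x (fst l) /\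
  is_derive (fun t => snd (f t)) x (snd l).

Lemma is_derive_C_unique (f : R -> C) (x : R) (l l' : C) :
  is_derive_C f x l -> is_derive_C f x l' -> l = l'.
Proof.
intros [H1 H2] [H1' H2']; apply injective_projections.
- apply is_derive_unique in H1; apply is_derive_unique in H1'; congruence.
- apply is_derive_unique in H2; apply is_derive_unique in H2'; congruence.
Qed.

Lemma is_derive_C_ext_loc (f g : R -> C) (x : R) (l : C) :
  locally x (fun t => f t = g t) -> is_derive_C f x l -> is_derive_C g x l.
Proof.
intros E [H1 H2]; split.
- apply (is_derive_ext_loc (fun t => fst (f t))); [|exact H1].
  revert E; apply filter_imp; intros t ->; reflexivity.
- apply (is_derive_ext_loc (fun t => snd (f t))); [|exact H2].
  revert E; apply filter_imp; intros t ->; reflexivity.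
Qed.

Lemma is_derive_C_plus (f g : R -> C) (x : R) (l l' : C) :
  is_derive_C f x l -> is_derive_C g x l' ->
  is_derive_C (fun t => f t + g t)%C x (l + l')%C.
Proof.
intros [H1 H2] [H1' H2']; split;
  apply (@is_derive_plus R_AbsRing R_NormedModule); assumption.
Qed.

Lemma is_derive_C_mult (f g : R -> C) (x : R) (l l' : C) :
  is_derive_C f x l -> is_derive_C g x l' ->
  is_derive_C (fun t => f t * g t)%C x (l * g x + f x * l')%C.
Proof.
intros [H1 H2] [H1' H2'].
assert (M : forall u v u' v', is_derive u x u' -> is_derive v x v' ->
  is_derive (fun t => u t * v t) x (u' * v x + u x * v')).
{ intros u v u' v' Hu Hv; apply (is_derive_mult u v x u' v' Hu Hv Rmult_comm). }
split; simpl.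
- evar_last.
  + apply (@is_derive_minus R_AbsRing R_NormedModule (fun t => fst (f t) * fst (g t))
       (fun t => snd (f t) * snd (g t))); apply M; eassumption.
  + unfold minus, plus, opp; simpl; ring.
- evar_last.
  + apply (@is_derive_plus R_AbsRing R_NormedModule (fun t => fst (f t) * snd (g t))
       (fun t => snd (f t) * fst (g t))); apply M; eassumption.
  + unfold plus; simpl; ring.
Qed.

Lemma is_derive_C_const (c : C) (x : R) : is_derive_C (fun _ => c) x (RtoC 0).
Proof. split; apply (@is_derive_const R_AbsRing R_NormedModule). Qed.

Lemma is_derive_C_scal (c : C) (f : R -> C) (x : R) (l : C) :
  is_derive_C f x l -> is_derive_C (fun t => c * f t)%C x (c * l)%C.
Proof.
intros H.
replace (c * l)%C with (RtoC 0 * f x + c * l)%C by ring.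
apply (is_derive_C_mult (fun _ => c)); [apply is_derive_C_const|exact H].
Qed.

Lemma is_derive_C_sum (f : nat -> R -> C) (x : R) (l : nat -> C) (n : nat) :
  (forall i, (i <= n)%nat -> is_derive_C (f i) x (l i)) ->
  is_derive_C (fun t => sum_n (fun i => f i t) n) x (sum_n l n).
Proof.
induction n as [|n IH]; intros H.
- rewrite sum_O.
  apply (is_derive_C_ext_loc (f 0%nat)); [|apply H; lia].
  apply filter_forall; intros t; rewrite sum_O; reflexivity.
- rewrite sum_Sn_C.
  apply (is_derive_C_ext_loc (fun t => sum_n (fun i => f i t) n + f (S n) t)%C).
  + apply filter_forall; intros t; rewrite sum_Sn_C; reflexivity.
  + apply is_derive_C_plus; [apply IH; intros; apply H; lia|apply H; lia].
Qed.

(** The family a_k = f^(k) / k! of Taylor coefficients of a function f = a_0 at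
    every point of (0,1), described without mentioning f. *)
Definition taylor_family (a : nat -> R -> C) : Prop :=
  forall k x, 0 < x < 1 -> is_derive_C (a k) x (RtoC (INR (S k)) * a (S k) x)%C.

Definition cauchy_product (u v : nat -> C) (k : nat) : C :=
  sum_n (fun i => u i * v (k - i)%nat)%C k.

(** Leibniz's rule.  Differentiating the product of a_i and b_(k-i) gives the
    weights i and k+1-i on the terms of the product of order k+1, which add up
    to k+1 on each of them. *)
Lemma taylor_family_mult (a b : nat -> R -> C) :
  taylor_family a -> taylor_family b ->
  taylor_family (fun k x => cauchy_product (fun i => a i x) (fun i => b i x) k).
Proof.
intros Ha Hb k x Hx.
unfold cauchy_product.
assert (E : (RtoC (INR (S k)) * sum_n (fun i => a i x * b (S k - i)%nat x) (S k))%C =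
  sum_n (fun i => RtoC (INR (S i)) * a (S i) x * b (k - i)%nat x
     + a i x * (RtoC (INR (S (k - i))) * b (S (k - i)) x))%C k).
{ rewrite sum_n_plus_C, <- sum_n_mult_C.
  transitivity (sum_n (fun i => RtoC (INR i) * (a i x * b (S k - i)%nat x)
      + RtoC (INR (S k - i)) * (a i x * b (S k - i)%nat x))%C (S k)).
  - apply sum_n_ext_C; intros i Hi.
    rewrite minus_INR by exact Hi. rewrite RtoC_minus; ring.
  - rewrite sum_n_plus_C; f_equal.
    + rewrite sum_n_first_C; simpl (INR 0).
      rewrite (sum_n_ext_C (fun i => RtoC (INR (S i)) * (a (S i) x * b (S k - S i)%nat x))%C
         (fun i => RtoC (INR (S i)) * a (S i) x * b (k - i)%nat x)%C).
      * C_ring.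
      * intros i _; simpl (S k - S i)%nat; C_ring.
    + rewrite sum_Sn_C.
      replace (S k - S k)%nat with 0%nat by lia; simpl (INR 0).
      rewrite (sum_n_ext_C (fun i => RtoC (INR (S k - i)) * (a i x * b (S k - i)%nat x))%C
         (fun i => a i x * (RtoC (INR (S (k - i))) * b (S (k - i)) x))%C).
      * C_ring.
      * intros i Hi; replace (S k - i)%nat with (S (k - i)) by lia; C_ring. }
rewrite E.
apply (is_derive_C_sum (fun i t => a i t * b (k - i)%nat t)%C).
intros i Hi; apply is_derive_C_mult; [apply Ha|apply Hb]; exact Hx.
Qed.

(** Each coefficient is determined by the derivative of the previous one, so an
    identity between functions gives the identities between all their
    Taylor coefficients. *)
Lemma taylor_family_unique (a b : nat -> R -> C) :
  taylor_family a -> taylor_family b ->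
  (forall x, 0 < x < 1 -> a 0%nat x = b 0%nat x) ->
  forall k x, 0 < x < 1 -> a k x = b k x.
Proof.
intros Ha Hb H0; induction k as [|k IH]; [exact H0|]; intros x Hx.
assert (L : locally x (fun t => a k t = b k t)).
{ assert (O : locally x (fun t => 0 < t < 1)).
  { apply (open_and (fun t => 0 < t) (fun t => t < 1)); [apply open_gt|apply open_lt|exact Hx]. }
  revert O; apply filter_imp; exact (IH). }
assert (E := is_derive_C_unique _ _ _ _ (is_derive_C_ext_loc _ _ _ _ L (Ha k x Hx)) (Hb k x Hx)).
assert (N : RtoC (INR (S k)) <> RtoC 0).
{ apply RtoC_neq_0, not_0_INR; lia. }
replace (a (S k) x) with (/ RtoC (INR (S k)) * (RtoC (INR (S k)) * a (S k) x))%C by (field; exact N).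
rewrite E; field; exact N.
Qed.

(** The k-th Taylor coefficient at 0 of t |-> exp (c t). *)
Definition exp_coef (c : C) (k : nat) : C := (c ^ k / RtoC (INR (fact k)))%C.

Lemma exp_coef_0 (c : C) : exp_coef c 0 = RtoC 1.
Proof.
unfold exp_coef; simpl Cpow; change (INR (fact 0)) with 1.
field; apply RtoC_neq_0; lra.
Qed.

Lemma exp_coef_S (c : C) (k : nat) :
  (RtoC (INR (S k)) * exp_coef c (S k) = c * exp_coef c k)%C.
Proof.
unfold exp_coef; rewrite Cpow_S, fact_simpl, mult_INR, RtoC_mult; field.
split; apply RtoC_neq_0, not_0_INR; [apply fact_neq_0|lia].
Qed.

(** * Taylor coefficients of the cotangent *)

Definition omega_taylor (k : nat) (x : R) : C := (exp_coef twopii k * omega x)%C.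

Lemma omega_taylor_family : taylor_family omega_taylor.
Proof.
intros k x _; unfold omega_taylor.
replace (RtoC (INR (S k)) * (exp_coef twopii (S k) * omega x))%C
  with (exp_coef twopii k * (twopii * omega x))%C
  by (rewrite (Cmult_assoc (RtoC (INR (S k)))), exp_coef_S; ring).
apply is_derive_C_scal; split; simpl; auto_derive; trivial; ring.
Qed.

(** For x in (0,1) this is the sum of (n + x)^-k over all integers n: the
    terms with n < 0 are, up to sign, those of the one-sided sum at 1 - x. *)
Definition hurwitz_sum (k : nat) (x : R) : R :=
  hurwitz k x + (-1) ^ k * hurwitz k (1 - x).

(** Taylor coefficients of pi cot (pi x) + i pi = 2 pi i w / (w - 1), with
    w = [omega x].  The constant i pi, which only affects the coefficient of
    order 0, makes the equation (w - 1) f = 2 pi i w as simple as possible. *)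
Definition cot_taylor (k : nat) (x : R) : C :=
  match k with
  | O => (PI * cos (PI * x) / sin (PI * x), PI)
  | _ => RtoC ((-1) ^ k * hurwitz_sum (S k) x)
  end.

Lemma is_derive_hurwitz_sum (k : nat) (x : R) : (2 <= k)%nat -> 0 < x < 1 ->
  is_derive (hurwitz_sum k) x (- INR k * hurwitz_sum (S k) x).
Proof.
intros Hk Hx; unfold hurwitz_sum.
assert (D : is_derive (fun t => hurwitz k (1 - t)) x (-1 * (- INR k * hurwitz (S k) (1 - x)))).
{ apply (is_derive_comp (hurwitz k) (fun t => 1 - t)).
  - apply is_derive_hurwitz; [exact Hk|lra].
  - auto_derive; [exact I|ring]. }
evar_last.
- apply (@is_derive_plus R_AbsRing R_NormedModule).
  + apply is_derive_hurwitz; [exact Hk|lra].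
  + apply is_derive_scal, D.
- unfold plus, scal; simpl; unfold mult; simpl; ring.
Qed.

(** At order 0 this is the evaluation of the bilateral sum of order two, since
    the derivative of pi cot (pi x) is -(pi / sin (pi x))^2; beyond, it is the
    termwise differentiation of the bilateral sums. *)
Lemma cot_taylor_family : taylor_family cot_taylor.
Proof.
intros k x Hx; pose proof PI_RGT_0.
assert (Hs : 0 < sin (PI * x)) by (apply sin_PI_mult_pos, Hx).
destruct k as [|k].
- assert (E2 : hurwitz_sum 2 x = (PI / sin (PI * x)) ^ 2).
  { rewrite <- hurwitz2_reflection by exact Hx; unfold hurwitz_sum; ring. }
  unfold cot_taylor; rewrite E2; split; unfold fst, snd, RtoC, Cmult; simpl INR.
  + evar_last.
    * auto_derive; [lra|reflexivity].
    * pose proof (sin2_cos2 (PI * x)) as E; unfold Rsqr in E.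
      set (c := cos (PI * x)) in *; set (d := sin (PI * x)) in *.
      replace ((PI / d) ^ 2) with (PI ^ 2 * (d * d + c * c) / d ^ 2) by (rewrite E; field; lra).
      unfold fst, snd; field; lra.
  + evar_last; [apply (@is_derive_const R_AbsRing R_NormedModule)|unfold zero; simpl; ring].
- assert (D := is_derive_hurwitz_sum (S (S k)) x ltac:(lia) Hx).
  split.
  + evar_last; [apply (is_derive_scal _ _ ((-1) ^ S k) _ D)|].
    unfold cot_taylor. rewrite <- RtoC_mult; unfold RtoC, fst. simpl pow. ring.
  + evar_last; [apply (@is_derive_const R_AbsRing R_NormedModule 0)|].
    unfold cot_taylor; rewrite <- RtoC_mult; reflexivity.
Qed.

(** The identity f w - f = 2 pi i w, differentiated k times and divided by k!. *)
Lemma cot_taylor_recurrence (k : nat) (x : R) : 0 < x < 1 ->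
  (cauchy_product (fun i => cot_taylor i x) (fun i => omega_taylor i x) k
    - cot_taylor k x = twopii * omega_taylor k x)%C.
Proof.
intros Hx.
enough (E : (cauchy_product (fun i => cot_taylor i x) (fun i => omega_taylor i x) k
   = cot_taylor k x + twopii * omega_taylor k x)%C) by (rewrite E; ring).
revert k x Hx; apply taylor_family_unique.
- apply taylor_family_mult; [apply cot_taylor_family|apply omega_taylor_family].
- intros k x Hx.
  replace (RtoC (INR (S k)) * (cot_taylor (S k) x + twopii * omega_taylor (S k) x))%C
   with (RtoC (INR (S k)) * cot_taylor (S k) x + twopii * (RtoC (INR (S k)) * omega_taylor (S k) x))%C by ring.
  apply is_derive_C_plus; [apply cot_taylor_family, Hx|].
  apply is_derive_C_scal, omega_taylor_family, Hx.
- intros x Hx; pose proof PI_RGT_0.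
  assert (Hs : 0 < sin (PI * x)) by (apply sin_PI_mult_pos, Hx).
  unfold cauchy_product; rewrite sum_O.
  unfold omega_taylor; rewrite exp_coef_0, Cmult_1_l.
  unfold cot_taylor, omega, twopii.
  replace (2 * PI * x) with (2 * (PI * x)) by ring.
  rewrite sin_2a, cos_2a.
  assert (E : cos (PI * x) * cos (PI * x) = 1 - sin (PI * x) * sin (PI * x)).
  { pose proof (sin2_cos2 (PI * x)) as E; unfold Rsqr in E; lra. }
  revert E Hs; generalize (cos (PI * x)) (sin (PI * x)); intros c s E Hs.
  apply injective_projections; simpl; rewrite E; field [E]; lra.
Qed.

(** * Bernoulli polynomials *)

Lemma is_pseries_CV_radius (a : nat -> R) (r l : R) :
  is_pseries a r l -> Rbar_le (Rabs r) (CV_radius a).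
Proof.
intros H; apply Rbar_not_lt_le; intros L.
apply (CV_disk_outside a r L), ex_series_lim_0.
exists l; apply is_pseries_R, H.
Qed.

(** The generating function of the Bernoulli polynomials is only given for
    t <> 0.  Multiplying both series by t makes them agree at 0 as well. *)
Lemma is_pseries_punctured_unique (a b : nat -> R) (r : R) :
  0 < r ->
  (forall t, 0 < Rabs t <= r -> exists l, is_pseries a t l /\ is_pseries b t l) ->
  forall n, a n = b n.
Proof.
intros Hr H n.
assert (Rr : Rabs r = r) by (apply Rabs_right; lra).
destruct (H r ltac:(lra)) as [l [Ha Hb]].
apply is_pseries_CV_radius in Ha; apply is_pseries_CV_radius in Hb.
rewrite Rr in Ha, Hb.
apply (PSeries_ext_recip (PS_incr_1 a) (PS_incr_1 b) (S n)).
- rewrite CV_radius_incr_1; eapply Rbar_lt_le_trans; [|apply Ha]; exact Hr.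
- rewrite CV_radius_incr_1; eapply Rbar_lt_le_trans; [|apply Hb]; exact Hr.
- exists (mkposreal r Hr); intros t Ht.
  change (Rabs (t - 0) < r) in Ht; rewrite Rminus_0_r in Ht.
  rewrite !PSeries_incr_1.
  destruct (Req_dec t 0) as [->|N]; [ring|].
  destruct (H t) as [m [A B]].
  { split; [apply Rabs_pos_lt, N|lra]. }
  rewrite (is_pseries_unique _ _ _ A), (is_pseries_unique _ _ _ B); reflexivity.
Qed.

Definition bernoulli_coef (B : nat -> R -> R) (x : R) (n : nat) : R :=
  B n x / INR (fact n).

(** The n-th Taylor coefficient at 0 of t |-> exp (y t), for real y. *)
Definition exp_coef_R (y : R) (n : nat) : R := y ^ n / INR (fact n).

Lemma bernoulli_pseries (B : nat -> R -> R) (x t : R) :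
  is_bernoulli B -> 0 < Rabs t <= 2 ->
  is_pseries (bernoulli_coef B x) t (t * exp (t * x) / (exp t - 1)).
Proof.
intros hB Ht; apply is_pseries_R.
assert (P : 0 < Rabs t < 2 * PI) by (pose proof PI2_1; lra).
apply (is_series_ext (fun n => B n x * (t ^ n / INR (fact n)))); [|apply hB, P].
intros n; unfold bernoulli_coef.
change (B n x * (t ^ n / INR (fact n)) = B n x / INR (fact n) * t ^ n); field.
apply INR_fact_neq_0.
Qed.

Lemma exp_pseries (y t : R) : is_pseries (exp_coef_R y) t (exp (t * y)).
Proof.
apply is_pseries_R.
assert (E := is_exp_Reals (t * y)); apply is_pseries_R in E.
revert E; apply is_series_ext; intros n; unfold exp_coef_R.
change (/ INR (fact n) * (t * y) ^ n = y ^ n / INR (fact n) * t ^ n).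
rewrite Rpow_mult_distr; field; apply INR_fact_neq_0.
Qed.

(** The generating function at x + y is the one at x times exp (t y). *)
Lemma bernoulli_addition (B : nat -> R -> R) (x y : R) (n : nat) : is_bernoulli B ->
  bernoulli_coef B (x + y) n
  = sum_n (fun j => bernoulli_coef B x j * exp_coef_R y (n - j)) n.
Proof.
intros hB; rewrite sum_n_Reals; revert n.
apply (is_pseries_punctured_unique _ (PS_mult (bernoulli_coef B x) (exp_coef_R y)) 1 Rlt_0_1).
intros t Ht; exists (t * exp (t * (x + y)) / (exp t - 1)); split.
- apply bernoulli_pseries; [exact hB|lra].
- replace (t * exp (t * (x + y)) / (exp t - 1))
    with (t * exp (t * x) / (exp t - 1) * exp (t * y)).
  + assert (L : forall a l, is_pseries a 2 l -> Rbar_lt (Rabs t) (CV_radius a)).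
    { intros a l Hl; apply is_pseries_CV_radius in Hl.
      eapply Rbar_lt_le_trans; [|apply Hl]; simpl; rewrite (Rabs_right 2); lra. }
    apply is_pseries_mult.
    * apply bernoulli_pseries; [exact hB|lra].
    * apply exp_pseries.
    * eapply L, bernoulli_pseries; [exact hB|rewrite Rabs_right; lra].
    * eapply L, exp_pseries.
  + rewrite Rmult_plus_distr_l, exp_plus; unfold Rdiv; ring.
Qed.

(** Between x and x + 1 the generating function grows by t exp (t x). *)
Lemma bernoulli_difference (B : nat -> R -> R) (x : R) (n : nat) : is_bernoulli B ->
  bernoulli_coef B (x + 1) n - bernoulli_coef B x n
  = match n with O => 0 | S m => exp_coef_R x m end.
Proof.
intros hB; revert n.
apply (is_pseries_punctured_unique
  (PS_minus (bernoulli_coef B (x + 1)) (bernoulli_coef B x))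
  (PS_incr_1 (exp_coef_R x)) 1 Rlt_0_1).
intros t Ht; exists (t * exp (t * x)); split.
- assert (N : exp t - 1 <> 0).
  { intros N; assert (E : exp t = exp 0) by (rewrite exp_0; lra).
    apply exp_inv in E; subst t; rewrite Rabs_R0 in Ht; lra. }
  replace (t * exp (t * x)) with
    (plus (t * exp (t * (x + 1)) / (exp t - 1)) (opp (t * exp (t * x) / (exp t - 1)))).
  + apply (@is_pseries_minus R_AbsRing R_NormedModule);
    apply bernoulli_pseries; (exact hB || lra).
  + rewrite Rmult_plus_distr_l, Rmult_1_r, exp_plus; unfold plus, opp; simpl; field; exact N.
- apply (@is_pseries_incr_1 R_AbsRing R_NormedModule), exp_pseries.
Qed.

(** * Sums of Bernoulli values over roots of unity *)

(** For a q-th root of unity w <> 1, the generating function of these numbers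
    is q t w e^t / (w e^t - 1): sum the geometric progression of ratio w e^t. *)
Definition bernoulli_sum (B : nat -> R -> R) (q : nat) (w : C) (k : nat) : C :=
  sum_n_m (fun s => RtoC (INR q ^ k * bernoulli_coef B (INR s / INR q) k) * w ^ s)%C 1 q.

Lemma RtoC_sum_n (a : nat -> R) (n : nat) :
  RtoC (sum_n a n) = sum_n (fun i => RtoC (a i)) n.
Proof.
induction n as [|n IH]; [rewrite !sum_O; reflexivity|].
rewrite sum_Sn_R, sum_Sn_C, RtoC_plus, IH; reflexivity.
Qed.

Lemma sum_n_telescope_C (h : nat -> C) (n : nat) :
  sum_n (fun i => h (S i) - h i)%C n = (h (S n) - h 0%nat)%C.
Proof.
induction n as [|n IH]; [rewrite sum_O; reflexivity|].
rewrite sum_Sn_C, IH; C_ring.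
Qed.

(** Taking the Cauchy product with the exponential series shifts the argument
    of the Bernoulli polynomials by 1/q, that is s to s + 1; multiplying by w
    shifts the power of w in the same way.  The difference telescopes and, as
    w^q = 1, leaves the difference of Bernoulli values at 1 + 1/q and 1/q. *)
Lemma bernoulli_sum_recurrence (B : nat -> R -> R) (q : nat) (w : C) (k : nat) :
  is_bernoulli B -> (0 < q)%nat -> (w ^ q)%C = RtoC 1 ->
  (w * cauchy_product (bernoulli_sum B q w) (exp_coef (RtoC 1)) k - bernoulli_sum B q w k
   = w * RtoC (match k with O => 0 | S m => INR q / INR (fact m) end))%C.
Proof.
intros hB Hq Hw.
destruct q as [|m]; [lia|]; set (q := S m) in *.
assert (Q : 0 < INR q) by (apply lt_0_INR; lia).
assert (E : forall k, bernoulli_sum B q w k =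
  sum_n (fun s => RtoC (INR q ^ k * bernoulli_coef B (INR (S s) / INR q) k) * w ^ S s)%C m).
{ intros j; unfold bernoulli_sum, q, sum_n; symmetry.
  apply (sum_n_m_S (fun s => RtoC (INR (S m) ^ j * bernoulli_coef B (INR s / INR (S m)) j) * w ^ s)%C). }
assert (F : cauchy_product (bernoulli_sum B q w) (exp_coef (RtoC 1)) k =
  sum_n (fun s => RtoC (INR q ^ k * bernoulli_coef B (INR (S (S s)) / INR q) k) * w ^ S s)%C m).
{ unfold cauchy_product.
  transitivity (sum_n (fun j => sum_n (fun s => w ^ S s * (RtoC (INR q ^ j * bernoulli_coef B (INR (S s) / INR q) j)
      * exp_coef (RtoC 1) (k - j))) m) k)%C.
  - apply sum_n_ext_C; intros j _; rewrite E, Cmult_comm, <- sum_n_mult_C.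
    apply sum_n_ext_C; intros s _; C_ring.
  - rewrite sum_n_switch; apply sum_n_ext_C; intros s _.
    rewrite sum_n_mult_C, Cmult_comm; f_equal.
    replace (INR (S (S s)) / INR q) with (INR (S s) / INR q + 1 / INR q)
      by (rewrite (S_INR (S s)); field; lra).
    rewrite bernoulli_addition by exact hB.
    rewrite RtoC_mult, RtoC_sum_n, <- sum_n_mult_C.
    apply sum_n_ext_C; intros j Hj.
    unfold exp_coef, exp_coef_R; rewrite Cpow_1_l, <- RtoC_div, <- !RtoC_mult by apply INR_fact_neq_0.
    f_equal.
    replace k with (j + (k - j))%nat at 2 by lia; rewrite pow_add.
    replace (1 / INR q) with (/ INR q) by (field; lra).
    rewrite pow_inv; field; split; [apply pow_nonzero; lra|apply INR_fact_neq_0]. }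
set (h := fun s => (RtoC (INR q ^ k * bernoulli_coef B (INR (S s) / INR q) k) * w ^ S s)%C).
transitivity (sum_n (fun s => h (S s) - h s)%C m).
- rewrite E, F, <- sum_n_mult_C.
  transitivity (sum_n (fun s => h (S s)) m - sum_n h m)%C.
  + f_equal; apply sum_n_ext_C; intros s _; unfold h; rewrite (Cpow_S _ (S s)); C_ring.
  + assert (A : forall s, (h (S s) = (h (S s) - h s) + h s)%C) by (intros; C_ring).
    rewrite (sum_n_ext_C _ _ m (fun s _ => A s)), sum_n_plus_C; C_ring.
- rewrite sum_n_telescope_C; unfold h.
  change (w ^ S (S m))%C with (w * w ^ q)%C; rewrite Hw, Cpow_1_r, Cmult_1_r.
  change (S m) with q.
  rewrite (S_INR q); change (INR 1) with 1.
  replace ((INR q + 1) / INR q) with (1 / INR q + 1) by (field; lra).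
  replace (bernoulli_coef B (1 / INR q + 1) k) with
    (bernoulli_coef B (1 / INR q) k + match k with O => 0 | S m => exp_coef_R (1 / INR q) m end)
    by (rewrite <- (bernoulli_difference B (1 / INR q) k hB); ring).
  rewrite Rmult_plus_distr_l, RtoC_plus.
  transitivity (w * RtoC (INR q ^ k * match k with O => 0 | S m0 => exp_coef_R (1 / INR q) m0 end))%C; [C_ring|].
  do 2 f_equal; destruct k as [|k]; [ring|].
  replace (1 / INR q) with (/ INR q) by (field; lra).
  unfold exp_coef_R; rewrite pow_inv, <- tech_pow_Rmult; field.
  split; [apply INR_fact_neq_0|apply pow_nonzero; lra].
Qed.

(** * Comparison of the two recurrences *)

Lemma omega_IZR (z : Z) : omega (IZR z) = RtoC 1.
Proof.
assert (S0 : sin (PI * IZR z) = 0) by (apply sin_eq_0_1; exists z; ring).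
unfold omega; rewrite Rmult_assoc, sin_2a, cos_2a_sin, S0.
apply injective_projections; simpl; ring.
Qed.

Lemma omega_neq_1 (x : R) : 0 < x < 1 -> omega x <> RtoC 1.
Proof.
intros Hx E; apply (f_equal fst) in E; unfold omega in E; simpl in E.
pose proof PI_RGT_0.
assert (Hs : 0 < sin (PI * x)) by (apply sin_PI_mult_pos, Hx).
rewrite Rmult_assoc, cos_2a_sin in E; nra.
Qed.

Lemma omega_pow (x : R) (n : nat) : (omega x ^ n)%C = omega (INR n * x).
Proof.
induction n as [|n IH].
- simpl Cpow; change (INR 0) with (IZR 0); rewrite Rmult_0_l, omega_IZR; reflexivity.
- rewrite Cpow_S, IH; unfold omega; rewrite S_INR.
  replace (2 * PI * ((INR n + 1) * x)) with (2 * PI * x + 2 * PI * (INR n * x)) by ring.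
  rewrite cos_plus, sin_plus; apply injective_projections; simpl; ring.
Qed.

(** The unknown u_k occurs in the k-th equation with the coefficient w - 1,
    next to terms of lower index only. *)
Lemma cauchy_recurrence_unique (w : C) (c u v : nat -> C) :
  w <> RtoC 1 -> c 0%nat = RtoC 1 ->
  (forall k, w * cauchy_product u c k - u k = w * cauchy_product v c k - v k)%C ->
  forall k, u k = v k.
Proof.
intros Hw Hc H k; induction k as [k IH] using (well_founded_induction lt_wf).
assert (L : forall u, exists R0, (forall v, (forall i, (i < k)%nat -> v i = u i) ->
   cauchy_product v c k = R0 + v k)%C).
{ clear -Hc; intros u; unfold cauchy_product; destruct k as [|k].
  - exists (RtoC 0); intros v _; rewrite sum_O; simpl (0 - 0)%nat; rewrite Hc; ring.
  - exists (sum_n (fun i => u i * c (S k - i)%nat)%C k); intros v Hv.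
    rewrite sum_Sn_C, Nat.sub_diag, Hc, Cmult_1_r; f_equal.
    apply sum_n_ext_C; intros i Hi; rewrite Hv by lia; reflexivity. }
destruct (L v) as [T HT].
specialize (H k); rewrite (HT u IH), (HT v) in H by (intros; reflexivity).
assert (N : (w - RtoC 1)%C <> RtoC 0).
{ intros N; apply Hw; replace w with ((w - RtoC 1) + RtoC 1)%C by ring; rewrite N; ring. }
assert (E : ((w - RtoC 1) * u k = (w - RtoC 1) * v k)%C).
{ replace ((w - RtoC 1) * u k)%C with ((w * (T + u k) - u k) - w * T)%C by ring.
  rewrite H; ring. }
replace (u k) with (/ (w - RtoC 1) * ((w - RtoC 1) * u k))%C by (field; exact N).
rewrite E; field; exact N.
Qed.

(** The generating function of the right-hand side at t = 2 pi i z is the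
    function 2 pi i w e^t / (w e^t - 1) of z, which is 2 pi i w / (w - 1) taken
    at x + z.  On coefficients: both sides satisfy the same recurrence. *)
Lemma cot_taylor_bernoulli (B : nat -> R -> R) (q : nat) (x : R) (k : nat) :
  is_bernoulli B -> (0 < q)%nat -> 0 < x < 1 -> (omega x ^ q)%C = RtoC 1 ->
  cot_taylor k x = (twopii ^ S k * bernoulli_sum B q (omega x) (S k) / RtoC (INR q))%C.
Proof.
intros hB Hq Hx Hw.
set (r := bernoulli_sum B q (omega x)).
assert (Q : RtoC (INR q) <> RtoC 0) by (apply RtoC_neq_0, not_0_INR; lia).
assert (W : (omega x - RtoC 1)%C <> RtoC 0).
{ intros N; apply (omega_neq_1 x Hx).
  replace (omega x) with ((omega x - RtoC 1) + RtoC 1)%C by ring; rewrite N; ring. }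
(* the recurrence at order 0 reads (w - 1) r_0 = 0; this allows reindexing by 1 *)
assert (r0 : r 0%nat = RtoC 0).
{ assert (E := bernoulli_sum_recurrence B q (omega x) 0 hB Hq Hw).
  unfold cauchy_product in E; rewrite sum_O in E; simpl (0 - 0)%nat in E.
  rewrite exp_coef_0 in E; fold r in E.
  replace (r 0%nat) with (/ (omega x - RtoC 1) * (omega x * (r 0%nat * RtoC 1) - r 0%nat))%C by (field; exact W).
  rewrite E; ring. }
revert k; apply (cauchy_recurrence_unique (omega x) (exp_coef twopii)).
- apply omega_neq_1, Hx.
- apply exp_coef_0.
- intros k.
  transitivity (twopii * omega_taylor k x)%C.
  + rewrite <- cot_taylor_recurrence by exact Hx; f_equal.
    unfold cauchy_product; rewrite <- sum_n_mult_C.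
    apply sum_n_ext_C; intros i _; unfold omega_taylor; ring.
  + assert (E := bernoulli_sum_recurrence B q (omega x) (S k) hB Hq Hw); fold r in E.
    assert (F : cauchy_product (fun i => twopii ^ S i * r (S i) / RtoC (INR q))%C (exp_coef twopii) k
      = (twopii ^ S k / RtoC (INR q) * cauchy_product r (exp_coef (RtoC 1)) (S k))%C).
    { unfold cauchy_product; rewrite sum_n_first_C, r0, Cmult_0_l, Cplus_0_l, <- sum_n_mult_C.
      apply sum_n_ext_C; intros i Hi; simpl (S k - S i)%nat; unfold exp_coef.
      rewrite Cpow_1_l.
      replace (S k) with (S i + (k - i))%nat by lia; rewrite Cpow_add_r.
      field; split; [apply RtoC_neq_0, INR_fact_neq_0|exact Q]. }
    rewrite F; fold r.
    transitivity (twopii ^ S k / RtoC (INR q) *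
      (omega x * cauchy_product r (exp_coef (RtoC 1)) (S k) - r (S k)))%C; [|field; exact Q].
    rewrite E; unfold omega_taylor, exp_coef; rewrite RtoC_div by apply INR_fact_neq_0.
    rewrite Cpow_S; field; split; [apply RtoC_neq_0, INR_fact_neq_0|exact Q].
Qed.

(** The k-th power of 2 pi i is real for k even and imaginary for k odd, so the
    real part picks the cosine or the sine of the angle; this is where the
    parity in [trig] and the sign of the closed form come from. *)
Lemma Re_twopii_pow (k : nat) (t : R) : (0 < k)%nat ->
  (-1) ^ (k - 1) * fst (twopii ^ k * omega t)%C
  = (-1) ^ ((k + 2) / 2) * (2 * PI) ^ k * trig k (2 * PI * t).
Proof.
intros Hk.
assert (E : forall m, (twopii ^ (2 * m))%C = RtoC ((-1) ^ m * (2 * PI) ^ (2 * m))).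
{ intros m; rewrite Cpow_mult_r, pow_mult, <- Rpow_mult_distr, RtoC_pow; f_equal.
  apply injective_projections; simpl; ring. }
destruct (Nat.Even_or_Odd k) as [[m ->]|[m ->]].
- replace ((2 * m + 2) / 2)%nat with (m + 1)%nat
    by (replace (2 * m + 2)%nat with ((m + 1) * 2)%nat by lia; rewrite Nat.div_mul; lia).
  unfold trig; replace (Nat.even (2 * m)) with true by (symmetry; apply Nat.even_spec; exists m; lia).
  destruct m as [|m]; [lia|].
  replace (2 * S m - 1)%nat with (S (2 * m)) by lia.
  rewrite E, pow_1_odd; unfold omega, RtoC, Cmult, fst, snd.
  rewrite (pow_add _ (S m) 1); ring.
- replace ((2 * m + 1 + 2) / 2)%nat with (m + 1)%nat
    by (apply (Nat.div_unique _ _ _ 1); lia).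
  unfold trig; replace (Nat.even (2 * m + 1)) with false.
  + replace (2 * m + 1 - 1)%nat with (2 * m)%nat by lia.
    rewrite Cpow_add_r, E, pow_1_even, Cpow_1_r; unfold omega, RtoC, twopii, Cmult, fst, snd.
    rewrite !pow_add; ring.
  + symmetry; rewrite <- Nat.negb_odd; replace (Nat.odd (2 * m + 1)) with true; [reflexivity|].
    symmetry; apply Nat.odd_spec; exists m; lia.
Qed.

Lemma sum_mult_R (c : R) (a : nat -> R) (q : nat) :
  sum_n_m (fun s => c * a s) 1 q = c * sum_n_m a 1 q.
Proof. apply (@sum_n_m_mult_l R_Ring). Qed.

Lemma sum_Sm_R (a : nat -> R) (q : nat) :
  sum_n_m a 1 (S q) = sum_n_m a 1 q + a (S q).
Proof. apply (@sum_n_Sm R_AbelianMonoid); lia. Qed.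

Lemma sum_Sm_C (a : nat -> C) (q : nat) :
  sum_n_m a 1 (S q) = (sum_n_m a 1 q + a (S q))%C.
Proof. apply (@sum_n_Sm C_AbelianMonoid); lia. Qed.

Lemma Re_twopii_pow_sum (c : nat -> R) (x : R) (k q : nat) : (0 < k)%nat ->
  (-1) ^ (k - 1) * fst (twopii ^ k * sum_n_m (fun s => RtoC (c s) * omega x ^ s)%C 1 q)%C
  = (-1) ^ ((k + 2) / 2) * (2 * PI) ^ k
    * sum_n_m (fun s => c s * trig k (2 * PI * INR s * x)) 1 q.
Proof.
intros Hk; induction q as [|q IH].
- rewrite !sum_n_m_zero by lia; unfold zero; simpl; ring.
- rewrite sum_Sm_R, sum_Sm_C, Rmult_plus_distr_l, <- IH.
  rewrite (Rmult_assoc (2 * PI)).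
  transitivity ((-1) ^ (k - 1) * fst (twopii ^ k * sum_n_m (fun s => RtoC (c s) * omega x ^ s)%C 1 q)%C
    + c (S q) * ((-1) ^ (k - 1) * fst (twopii ^ k * omega (INR (S q) * x))%C)).
  + rewrite omega_pow.
    generalize (omega (INR (S q) * x)) (twopii ^ k)%C
     (sum_n_m (fun s => RtoC (c s) * omega x ^ s)%C 1 q); intros z p S0.
    unfold RtoC, Cmult, Cplus, fst, snd; ring.
  + rewrite Re_twopii_pow by exact Hk; ring.
Qed.

(** Real parts of [cot_taylor_bernoulli] at order k - 1. *)
Lemma hurwitz_sum_bernoulli (B : nat -> R -> R) (q : nat) (x : R) (k : nat) :
  is_bernoulli B -> (0 < q)%nat -> 0 < x < 1 -> (exists z : Z, INR q * x = IZR z) ->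
  (1 < k)%nat ->
  hurwitz_sum k x = (-1) ^ ((k + 2) / 2)%nat
     * ((2 * PI * INR q) ^ k / (INR q * INR (fact k)))
     * sum_n_m (fun s : nat => B k (INR s / INR q) * trig k (2 * PI * INR s * x)) 1 q.
Proof.
intros hB Hq Hx [z Hz] Hk.
assert (Q : INR q <> 0) by (apply not_0_INR; lia).
assert (W : (omega x ^ q)%C = RtoC 1) by (rewrite omega_pow, Hz; apply omega_IZR).
assert (E := cot_taylor_bernoulli B q x (k - 1) hB Hq Hx W).
replace (S (k - 1)) with k in E by lia.
unfold bernoulli_sum in E.
(* the sign of [cot_taylor] moves to the other side *)
assert (S2 : (-1) ^ (k - 1) * (-1) ^ (k - 1) = 1).
{ rewrite <- Rpow_mult_distr; replace (-1 * -1) with 1 by ring; apply pow1. }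
assert (F : cot_taylor (k - 1) x = RtoC ((-1) ^ (k - 1) * hurwitz_sum k x)).
{ destruct k as [|[|k]]; [lia|lia|]; simpl (S (S k) - 1)%nat; reflexivity. }
rewrite F in E; apply (f_equal fst) in E.
assert (D : forall u : C, fst (u / RtoC (INR q))%C = fst u / INR q).
{ intros u; unfold Cdiv; rewrite <- RtoC_inv by exact Q; unfold RtoC, Cmult, fst, snd; field; exact Q. }
rewrite D in E; change (fst (RtoC ?a)) with a in E.
transitivity ((-1) ^ (k - 1) * ((-1) ^ (k - 1) * hurwitz_sum k x)).
{ rewrite <- Rmult_assoc, S2; ring. }
rewrite E.
unfold Rdiv at 1; rewrite <- Rmult_assoc, Re_twopii_pow_sum by lia.
rewrite (sum_n_m_ext (fun s => INR q ^ k * bernoulli_coef B (INR s / INR q) k * trig k (2 * PI * INR s * x))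
  (fun s => (INR q ^ k / INR (fact k)) * (B k (INR s / INR q) * trig k (2 * PI * INR s * x)))).
- rewrite sum_mult_R.
  rewrite (Rpow_mult_distr (2 * PI)); field.
  split; [apply INR_fact_neq_0|exact Q].
- intros s; unfold bernoulli_coef; simpl; field; apply INR_fact_neq_0.
Qed.

(** * Bilateral series *)

Lemma bilateral_hurwitz_sum (k : nat) (x : R) : (2 <= k)%nat -> 0 < x < 1 ->
  is_bilateral_series (fun n => 1 / (IZR n + x) ^ k) (hurwitz_sum k x).
Proof.
intros Hk Hx.
assert (P : forall n y, 0 < y -> 0 < / (INR n + y) ^ k).
{ intros n y Hy; apply Rinv_0_lt_compat, pow_lt; pose proof (pos_INR n); lra. }
assert (E1 : forall n, 1 / (IZR (Z.of_nat n) + x) ^ k = / (INR n + x) ^ k).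
{ intros n; rewrite <- INR_IZR_INZ; unfold Rdiv; ring. }
assert (E2 : forall n, 1 / (IZR (- Z.of_nat (S n)) + x) ^ k = (-1) ^ k * / (INR n + (1 - x)) ^ k).
{ intros n; rewrite opp_IZR, <- INR_IZR_INZ, S_INR.
  replace (- (INR n + 1) + x) with (-1 * (INR n + (1 - x))) by ring.
  rewrite Rpow_mult_distr; unfold Rdiv; rewrite Rinv_mult, <- pow_inv.
  replace (/ -1) with (-1) by field; ring. }
assert (A : forall y, 0 < y -> ex_series (fun n => / (INR n + y) ^ k)).
{ intros y Hy; apply ex_series_hurwitz; assumption. }
repeat split.
- apply (ex_series_ext (fun n => / (INR n + x) ^ k)); [|apply A; lra].
  intros n; rewrite E1, Rabs_right; [reflexivity|left; apply P; lra].
- apply (ex_series_ext (fun n => / (INR n + (1 - x)) ^ k)); [|apply A; lra].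
  intros n; rewrite E2, Rabs_mult, pow_1_abs, Rmult_1_l, Rabs_right; [reflexivity|left; apply P; lra].
- rewrite (Series_ext _ _ E1), (Series_ext _ _ E2), Series_scal_l; reflexivity.
Qed.

Lemma is_bilateral_series_ext (a b : Z -> R) (l : R) :
  (forall n, a n = b n) -> is_bilateral_series a l -> is_bilateral_series b l.
Proof.
intros E [H1 [H2 H3]]; repeat split.
- revert H1; apply ex_series_ext; intros n; rewrite E; reflexivity.
- revert H2; apply ex_series_ext; intros n; rewrite E; reflexivity.
- rewrite <- H3; f_equal; apply Series_ext; intros n; rewrite E; reflexivity.
Qed.

(** Shifting the index by one moves a single term across the cut at 0.  Both
    series are first expressed through the two halves that share the term of
    index 0. *)
Lemma is_bilateral_series_succ (a : Z -> R) (l : R) :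
  is_bilateral_series a l <-> is_bilateral_series (fun n => a (n + 1)%Z) l.
Proof.
assert (E1 : forall n : nat, (Z.of_nat n + 1 = Z.of_nat (S n))%Z) by (intros; lia).
assert (E2 : forall n : nat, (- Z.of_nat (S (S n)) + 1 = - Z.of_nat (S n))%Z) by (intros; lia).
set (u := fun n => a (Z.of_nat n)).
set (v := fun n => a (- Z.of_nat n)%Z).
assert (X : forall l, is_bilateral_series a l <->
  ex_series (fun n => Rabs (u n)) /\ ex_series (fun n => Rabs (v n)) /\
  Series u + Series v - u 0%nat = l).
{ intros l0; unfold is_bilateral_series; fold u.
  change (fun n => a (- Z.of_nat (S n))%Z) with (fun n => v (S n)).
  change (fun n => Rabs (a (- Z.of_nat (S n))%Z)) with (fun n => Rabs (v (S n))).
  change (fun n => Rabs (a (Z.of_nat n))) with (fun n => Rabs (u n)).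
  rewrite <- (ex_series_incr_1 (fun n => Rabs (v n))).
  split; intros [H1 [H2 H3]]; repeat split; try assumption; rewrite <- H3.
  - rewrite (Series_incr_1 v) by (apply ex_series_Rabs, H2).
    replace (v 0%nat) with (u 0%nat) by reflexivity; ring.
  - rewrite (Series_incr_1 v) by (apply ex_series_Rabs, H2).
    replace (v 0%nat) with (u 0%nat) by reflexivity; ring. }
rewrite X; unfold is_bilateral_series.
assert (Y1 : forall n, a (Z.of_nat n + 1)%Z = u (S n)) by (intros n; rewrite E1; reflexivity).
assert (Y2 : forall n, a (- Z.of_nat (S n) + 1)%Z = v n).
{ intros n; unfold v; f_equal; lia. }
rewrite (Series_ext _ _ Y1), (Series_ext _ _ Y2).
assert (Z1 : ex_series (fun n => Rabs (a (Z.of_nat n + 1)%Z)) <-> ex_series (fun n => Rabs (u n))).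
{ rewrite (ex_series_incr_1 (fun n => Rabs (u n))).
  split; apply ex_series_ext; intros n; rewrite Y1; reflexivity. }
assert (Z2 : ex_series (fun n => Rabs (a (- Z.of_nat (S n) + 1)%Z)) <-> ex_series (fun n => Rabs (v n))).
{ split; apply ex_series_ext; intros n; rewrite Y2; reflexivity. }
rewrite Z1, Z2.
split; intros [H1 [H2 H3]]; repeat split; try assumption; rewrite <- H3;
  rewrite (Series_incr_1 u) by (apply ex_series_Rabs, H1); ring.
Qed.

Lemma is_bilateral_series_shift (a : Z -> R) (l : R) (m : Z) :
  is_bilateral_series a l -> is_bilateral_series (fun n => a (n + m)%Z) l.
Proof.
intros H; pattern m; apply Z.peano_ind; clear m.
- revert H; apply is_bilateral_series_ext; intros n; f_equal; lia.
- intros m IH; apply is_bilateral_series_succ in IH; revert IH.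
  apply is_bilateral_series_ext; intros n; f_equal; lia.
- intros m IH; apply is_bilateral_series_succ; revert IH.
  apply is_bilateral_series_ext; intros n; f_equal; lia.
Qed.

Lemma Qfrac_itv (alpha : Q) :
  (~ exists m : Z, (alpha == inject_Z m)%Q) -> 0 < Q2R (Qfrac alpha) < 1.
Proof.
intros H.
assert (L := Qfloor_le alpha); assert (U := Qlt_floor alpha).
apply Qle_Rle in L; apply Qlt_Rlt in U.
assert (IQ : forall z, Q2R (inject_Z z) = IZR z).
{ intros z; unfold Q2R, inject_Z; simpl; field. }
rewrite IQ in L; rewrite IQ, plus_IZR in U.
unfold Qfrac; rewrite Q2R_minus, IQ.
split; [|lra].
destruct L as [L|L]; [lra|exfalso; apply H; exists (Qfloor alpha)].
apply eqR_Qeq; rewrite IQ; symmetry; exact L.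
Qed.

Lemma denominator_spec (r : Q) :
  (0 < denominator r)%nat /\ exists z : Z, INR (denominator r) * Q2R r = IZR z.
Proof.
unfold denominator; split; [lia|exists (Qnum (Qred r))].
rewrite <- (Qeq_eqR _ _ (Qred_correct r)); unfold Q2R.
rewrite INR_IZR_INZ, positive_nat_Z; field.
apply eq_IZR_contrapositive; discriminate.
Qed.

Theorem theorem1 (k : nat) (hk : (1 < k)%nat)
    (alpha : Q) (halpha : ~ exists m : Z, (alpha == inject_Z m)%Q)
    (B : nat -> R -> R) (hB : is_bernoulli B) :
  let alphat : Q := Qfrac alpha in
  let q : nat := denominator alphat in
  is_bilateral_series
    (fun n : Z => 1 / (IZR n + Q2R alpha) ^ k)
    ((-1) ^ ((k + 2) / 2)%nat
     * ((2 * PI * INR q) ^ k / (INR q * INR (fact k)))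
     * sum_n_m (fun s : nat =>
         B k (INR s / INR q) * trig k (2 * PI * INR s * Q2R alphat)) 1 q).
Proof.
intros alphat q.
pose proof (Qfrac_itv alpha halpha) as Hx; fold alphat in Hx.
destruct (denominator_spec alphat) as [Hq Hz]; fold q in Hq, Hz.
rewrite <- (hurwitz_sum_bernoulli B q (Q2R alphat) k hB Hq Hx Hz hk).
assert (H := bilateral_hurwitz_sum k (Q2R alphat) ltac:(lia) Hx).
apply (is_bilateral_series_shift _ _ (Qfloor alpha)) in H; revert H.
apply is_bilateral_series_ext; intros n.
unfold alphat, Qfrac; rewrite Q2R_minus, plus_IZR.
replace (Q2R (inject_Z (Qfloor alpha))) with (IZR (Qfloor alpha))
  by (unfold Q2R, inject_Z; simpl; field).
do 2 f_equal; ring.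
Qed.
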